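(* Let $n$ be a positive integer and let $N_n$ be the free $2$-step nilpotent group of rank $n$ on $x_1,\dots,x_n$. The map $\phi\colon UVB_n\to\operatorname{Aut}(N_n)$, sending each generator $\sigma_i$ to the automorphism $x_i\mapsto x_ix_{i+1}x_i^{-1}$, $x_{i+1}\mapsto x_i$, $x_l\mapsto x_l$ for $l\neq i,i+1$, and each generator $\rho_i$ to the automorphism $x_i\mapsto x_{i+1}$, $x_{i+1}\mapsto x_i$, $x_l\mapsto x_l$ for $l\neq i,i+1$, is a representation of $UVB_n$ (i.e. it is a well-defined group homomorphism).
   Context: The group of unrestricted virtual braids $UVB_n$ is the group with generators $\sigma_1,\dots,\sigma_{n-1},\rho_1,\dots,\rho_{n-1}$ and defining relations: (R1) $\sigma_i\sigma_{i+1}\sigma_i=\sigma_{i+1}\sigma_i\sigma_{i+1}$ for $1\le i\le n-2$; (R2) $\sigma_i\sigma_j=\sigma_j\sigma_i$ for $|i-j|\ge 2$; (R3) $\rho_i\rho_{i+1}\rho_i=\rho_{i+1}\rho_i\rho_{i+1}$ for $1\le i\le n-2$; (R4) $\rho_i\rho_j=\rho_j\rho_i$ for $|i-j|\ge 2$; (R5) $\rho_i^2=1$ for $1\le i\le n-1$; (R6) $\sigma_i\rho_j=\rho_j\sigma_i$ for $|i-j|\ge 2$; (M) $\rho_i\rho_{i+1}\sigma_i=\sigma_{i+1}\rho_i\rho_{i+1}$ for $1\le i\le n-2$; (F1) $\rho_i\sigma_{i+1}\sigma_i=\sigma_{i+1}\sigma_i\rho_{i+1}$ for $1\le i\le n-2$;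 (F2) $\rho_{i+1}\sigma_i\sigma_{i+1}=\sigma_i\sigma_{i+1}\rho_i$ for $1\le i\le n-2$. $N_n=F_n/\gamma_3F_n$, where $F_n$ is the free group on $x_1,\dots,x_n$ and $\gamma_3F_n=[F_n,[F_n,F_n]]$; the images of the $x_i$ in $N_n$ are again denoted $x_i$. Products of automorphisms are read from left to right: in a product $\alpha\beta$, $\alpha$ is applied first and then $\beta$. *)

(* Defs.v *)
From HB Require Import structures.
From mathcomp Require Import all_boot generic_quotient.
From mathcomp Require Import boolp classical_sets.

Set Implicit Arguments.
Unset Strict Implicit.
Unset Printing Implicit Defensive.

Local Open Scope classical_set_scope.
Local Open Scope group_scope.

Section FreeGroup.
Variable X : choiceType.

(* (x, true) stands for x and (x, false) for x^-1. *)
Definition letter : Type := (X * bool)%type.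

Definition invl (a : letter) : letter := (a.1, ~~ a.2).

Lemma invlK : involutive invl.
Proof. by case=> x b; rewrite /invl /= negbK. Qed.

Definition noncancelling (a b : letter) := b != invl a.

Definition reduced (s : seq letter) := sorted noncancelling s.

Record free_group := FreeGroup {
  word :> seq letter;
  word_reduced : reduced word }.

HB.instance Definition _ := [isSub for word].
HB.instance Definition _ := [Choice of free_group by <:].

Definition push (a : letter) (s : seq letter) :=
  if s is b :: t then if b == invl a then t else a :: s else [:: a].

Lemma push_reduced a s : reduced s -> reduced (push a s).
Proof.
case: s => [|b t] //= pt; case: ifPn => [_|ab]; first exact: path_sorted pt.
by rewrite /reduced /= /noncancelling ab.
Qed.

Lemma pushK a s : reduced s -> push a (push (invl a) s) = s.
Proof.
case: s => [|b t] /=; first by rewrite eqxx.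
rewrite invlK; case: (eqVneq b a) => [->|_ _ /=]; last by rewrite eqxx.
by case: t => [|c t] //= /andP[/negbTE ca _]; rewrite ca.
Qed.

Lemma foldr_push_reduced s t : reduced t -> reduced (foldr push t s).
Proof. by move=> rt; elim: s => //= a s; apply: push_reduced. Qed.

Definition free_one := @FreeGroup [::] isT.

Definition free_mul (u v : free_group) :=
  FreeGroup (foldr_push_reduced u (word_reduced v)).

Lemma inv_reduced s : reduced s -> reduced (rev (map invl s)).
Proof.
move=> rs; rewrite /reduced rev_sorted sorted_map.
apply: sub_sorted rs => a b; rewrite /noncancelling /relpre /=.
by rewrite invlK eq_sym.
Qed.

Definition free_inv (u : free_group) := FreeGroup (inv_reduced (word_reduced u)).

Lemma foldr_push0 s : reduced s -> foldr push [::] s = s.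
Proof.
elim: s => //= a s IHs /[dup] rs /path_sorted/IHs ->.
by case: s rs {IHs} => //= b s /andP[/negbTE ba _]; rewrite ba.
Qed.

Lemma foldr_push_push a s t :
  reduced t -> foldr push t (push a s) = push a (foldr push t s).
Proof.
case: s => //= b s rt; case: (eqVneq b (invl a)) => //= ->.
by rewrite pushK //; apply: foldr_push_reduced.
Qed.

Lemma free_mulA : associative free_mul.
Proof.
move=> u v w; apply: val_inj => /=; elim: (word u) => //= a s ->.
by rewrite foldr_push_push //; apply: word_reduced.
Qed.

Lemma free_mul1 : left_id free_one free_mul.
Proof. by move=> u; apply: val_inj. Qed.

Lemma free_mulr1 : right_id free_one free_mul.
Proof. by move=> u; apply/val_inj/foldr_push0/word_reduced. Qed.

Lemma free_mulV : left_inverse free_one free_inv free_mul.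
Proof.
case=> s rs; apply: val_inj => /=; elim: s rs => //= a s IHs rs.
by rewrite rev_cons -cats1 foldr_cat /= invlK eqxx (IHs (path_sorted rs)).
Qed.

Lemma free_mulrV : right_inverse free_one free_inv free_mul.
Proof.
move=> u; rewrite -{1}[u](_ : free_inv (free_inv u) = u) ?free_mulV //.
apply: val_inj => /=.
by rewrite map_rev revK -map_comp map_id_in // => a _; apply: invlK.
Qed.

HB.instance Definition _ := isGroup.Build free_group
  free_mulA free_mul1 free_mulr1 free_mulV free_mulrV.

Definition free_gen (x : X) : free_group := @FreeGroup [:: (x, true)] isT.

End FreeGroup.

Section Subgroups.
Variable G : groupType.
Implicit Types A B H : set G.

Definition subgroup H : Prop :=
  [/\ H 1, forall x y, H x -> H y -> H (x * y) & forall x, H x -> H x^-1].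

Definition normal_subgroup H : Prop :=
  subgroup H /\ forall x g, H x -> H (x ^ g).

Record normalSubgroup := NormalSubgroup {
  nsub_set :> G -> Prop;
  nsubP : normal_subgroup nsub_set }.

Definition generated A : set G := smallest subgroup A.

Definition commutator_subgroup A B : set G :=
  generated [set [~ a, b] | a in A & b in B].

Lemma generated_subgroup A : subgroup (generated A).
Proof.
split=> [H [[]]//|x y Hx Hy H HA|x Hx H HA]; have [[_ HM HV] _] := HA.
  by apply: HM; [apply: Hx|apply: Hy].
by apply: HV; apply: Hx.
Qed.

Lemma generated_normal A :
  (forall x g, A x -> A (x ^ g)) -> normal_subgroup (generated A).
Proof.
move=> AJ; split; first exact: generated_subgroup.
move=> x g Ax H [[H1 HM HV] sAH].
pose K : set G := [set y | H (y ^ g)].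
suff: K x by [].
apply: Ax; split; last by move=> y Ay; apply/sAH/AJ.
split; rewrite /K /=; first by rewrite conj1g.
  by move=> y z Hy Hz; rewrite conjMg; apply: HM.
by move=> y Hy; rewrite conjVg; apply: HV.
Qed.

Lemma commutator_normal A B :
    (forall x g, A x -> A (x ^ g)) -> (forall x g, B x -> B (x ^ g)) ->
  normal_subgroup (commutator_subgroup A B).
Proof.
move=> AJ BJ; apply: generated_normal => _ g [a Aa [b Bb <-]].
exists (a ^ g); first exact: AJ.
by exists (b ^ g); [exact: BJ|rewrite conjRg].
Qed.

Definition gamma3_set : set G :=
  commutator_subgroup setT (commutator_subgroup setT setT).

Lemma gamma3_normal : normal_subgroup gamma3_set.
Proof.
apply: commutator_normal => //.
by have [] : normal_subgroup (commutator_subgroup setT setT)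
  by apply: commutator_normal.
Qed.

Definition gamma3 : normalSubgroup := NormalSubgroup gamma3_normal.

Lemma normal_closure_normal A : normal_subgroup (smallest normal_subgroup A).
Proof.
split; first split.
- by move=> H [[[]]].
- move=> x y Hx Hy H HA; have [[[_ HM _] _] _] := HA.
  by apply: HM; [apply: Hx|apply: Hy].
- by move=> x Hx H HA; have [[[_ _ HV] _] _] := HA; apply: HV; apply: Hx.
by move=> x g Hx H HA; have [[_ HJ] _] := HA; apply: HJ; apply: Hx.
Qed.

Definition normal_closure A : normalSubgroup :=
  NormalSubgroup (normal_closure_normal A).

End Subgroups.

Section QuotientGroup.
Variables (G : groupType) (N : normalSubgroup G).

Definition coset_rel (x y : G) : bool := `[< N (x^-1 * y) >].

Lemma coset_rel_refl : reflexive coset_rel.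
Proof. by move=> x; apply/asboolP; rewrite mulVg; have [[]] := nsubP N. Qed.

Lemma coset_rel_sym : symmetric coset_rel.
Proof.
have [[_ _ NV] _] := nsubP N.
by move=> x y; apply/asboolP/asboolP=> /NV; rewrite invgM invgK.
Qed.

Lemma coset_rel_trans : transitive coset_rel.
Proof.
have [[_ NM _] _] := nsubP N.
move=> y x z /asboolP Nxy /asboolP Nyz; apply/asboolP.
by have := NM _ _ Nxy Nyz; rewrite -mulgA mulVKg.
Qed.

Canonical coset_equiv :=
  EquivRel coset_rel coset_rel_refl coset_rel_sym coset_rel_trans.

Definition quotient_group : Type := {eq_quot coset_rel}%qT.

HB.instance Definition _ := Choice.on quotient_group.
HB.instance Definition _ := EqQuotient.on quotient_group.

Definition proj (x : G) : quotient_group := (\pi_quotient_group x)%qT.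

Lemma projP x y : reflect (proj x = proj y) (coset_rel x y).
Proof. by apply: (iffP idP) => /eqmodP. Qed.

Lemma proj_repr (u : quotient_group) : proj (repr u) = u.
Proof. exact: reprK. Qed.

Lemma repr_proj x : coset_rel (repr (proj x)) x.
Proof. by apply/projP; rewrite proj_repr. Qed.

Definition quotient_mul (u v : quotient_group) := proj (repr u * repr v).
Definition quotient_inv (u : quotient_group) := proj (repr u)^-1.

Lemma quotient_mulE x y : quotient_mul (proj x) (proj y) = proj (x * y).
Proof.
apply/projP/asboolP; have [[_ NM _] NJ] := nsubP N.
have /asboolP Nx := repr_proj x; have /asboolP Ny := repr_proj y.
set x' := repr (proj x) in Nx *; set y' := repr (proj y) in Ny *.
have -> : (x' * y')^-1 * (x * y) = (x'^-1 * x) ^ y' * (y'^-1 * y).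
  by rewrite conjgE invgM !mulgA mulgK.
by apply: NM => //; apply: NJ.
Qed.

Lemma quotient_invE x : quotient_inv (proj x) = proj x^-1.
Proof.
apply/projP/asboolP; have [[_ _ NV] NJ] := nsubP N.
have /asboolP := repr_proj x; move: (repr _) => x' /NV /(NJ _ x'^-1).
by rewrite conjgE invgM !invgK !mulgA mulgK.
Qed.

Lemma quotient_mulA : associative quotient_mul.
Proof.
move=> u v w; rewrite -[u]proj_repr -[v]proj_repr -[w]proj_repr.
by rewrite !quotient_mulE mulgA.
Qed.

Lemma quotient_mul1 : left_id (proj 1) quotient_mul.
Proof. by move=> u; rewrite -[u]proj_repr quotient_mulE mul1g. Qed.

Lemma quotient_mulr1 : right_id (proj 1) quotient_mul.
Proof. by move=> u; rewrite -[u]proj_repr quotient_mulE mulg1. Qed.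

Lemma quotient_mulV : left_inverse (proj 1) quotient_inv quotient_mul.
Proof.
by move=> u; rewrite -[u]proj_repr quotient_invE quotient_mulE mulVg.
Qed.

Lemma quotient_mulrV : right_inverse (proj 1) quotient_inv quotient_mul.
Proof.
by move=> u; rewrite -[u]proj_repr quotient_invE quotient_mulE mulgV.
Qed.

HB.instance Definition _ := isGroup.Build quotient_group
  quotient_mulA quotient_mul1 quotient_mulr1 quotient_mulV quotient_mulrV.

Lemma projM : {morph proj : x y / x * y}.
Proof. by move=> x y; rewrite -quotient_mulE. Qed.

HB.instance Definition _ := isMultiplicative.Build G quotient_group proj projM.

End QuotientGroup.

Definition presented_group (X : choiceType)
    (rel : free_group X -> free_group X -> Prop) : groupType :=
  quotient_group
    (normal_closure [set w | exists u v, rel u v /\ w = u * v^-1]).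

Section Automorphisms.
Variable G : groupType.

Record aut := Aut {
  aut_fun :> G -> G;
  autM : {morph aut_fun : x y / x * y};
  aut_bij : bijective aut_fun }.

HB.instance Definition _ := gen_eqMixin aut.
HB.instance Definition _ := gen_choiceMixin aut.

Lemma aut_eq (f g : aut) : f =1 g -> f = g.
Proof.
case: f g => [f fM fB] [g gM gB] /= /funext fg; rewrite {}fg in fM fB *.
by congr Aut; apply: Prop_irrelevance.
Qed.

Definition aut_one : aut := Aut (fun _ _ => erefl) (Bijective (frefl id) (frefl id)).

(* Products are read from left to right: f is applied first. *)
Definition aut_mul (f g : aut) : aut.
Proof.
exists (fun x => g (f x)); first by move=> x y; rewrite !autM.
exact: bij_comp (aut_bij g) (aut_bij f).
Defined.

Lemma aut_inv_subproof (f : aut) : exists g : aut, cancel f g /\ cancel g f.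
Proof.
have [g fK gK] := aut_bij f.
have gM : {morph g : x y / x * y}.
  by move=> x y; rewrite -{1}[x]gK -{1}[y]gK -autM fK.
by exists (Aut gM (Bijective gK fK)).
Qed.

Definition aut_inv (f : aut) : aut := sval (cid (aut_inv_subproof f)).

Lemma aut_mulA : associative aut_mul.
Proof. by move=> f g h; apply: aut_eq. Qed.

Lemma aut_mul1 : left_id aut_one aut_mul.
Proof. by move=> f; apply: aut_eq. Qed.

Lemma aut_mulr1 : right_id aut_one aut_mul.
Proof. by move=> f; apply: aut_eq. Qed.

Lemma aut_mulV : left_inverse aut_one aut_inv aut_mul.
Proof.
by move=> f; apply: aut_eq => x /=; rewrite /aut_inv; case: cid => g [].
Qed.

Lemma aut_mulrV : right_inverse aut_one aut_inv aut_mul.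
Proof.
by move=> f; apply: aut_eq => x /=; rewrite /aut_inv; case: cid => g [].
Qed.

HB.instance Definition _ := isGroup.Build aut
  aut_mulA aut_mul1 aut_mulr1 aut_mulV aut_mulrV.

End Automorphisms.

(* Indices are shifted to start at 0. *)

Section UVB.
Variable n : nat.
Implicit Types i j : 'I_n.-1.

(* inl i is the letter sigma_i and inr i is the letter rho_i. *)
Definition uvb_letter : choiceType := ('I_n.-1 + 'I_n.-1)%type.

Definition free_sigma i : free_group uvb_letter := free_gen (inl i : uvb_letter).
Definition free_rho i : free_group uvb_letter := free_gen (inr i : uvb_letter).
Local Notation s := free_sigma.
Local Notation r := free_rho.

Definition far (i j : 'I_n.-1) : bool := (i.+2 <= j) || (j.+2 <= i).

Inductive uvb_rel : free_group uvb_letter -> free_group uvb_letter -> Prop :=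
| R1 i j of j = i.+1 :> nat : uvb_rel (s i * s j * s i) (s j * s i * s j)
| R2 i j of far i j : uvb_rel (s i * s j) (s j * s i)
| R3 i j of j = i.+1 :> nat : uvb_rel (r i * r j * r i) (r j * r i * r j)
| R4 i j of far i j : uvb_rel (r i * r j) (r j * r i)
| R5 i : uvb_rel (r i ^+ 2) 1
| R6 i j of far i j : uvb_rel (s i * r j) (r j * s i)
| RM i j of j = i.+1 :> nat : uvb_rel (r i * r j * s i) (s j * r i * r j)
| RF1 i j of j = i.+1 :> nat : uvb_rel (r i * s j * s i) (s j * s i * r j)
| RF2 i j of j = i.+1 :> nat : uvb_rel (r j * s i * s j) (s i * s j * r i).

Definition UVB : groupType := presented_group uvb_rel.

Definition sigma (i : 'I_n.-1) : UVB := proj _ (s i).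
Definition rho (i : 'I_n.-1) : UVB := proj _ (r i).

End UVB.

Definition Nil2 (n : nat) : groupType :=
  quotient_group (gamma3 (free_group 'I_n)).

Definition xgen (n : nat) (i : 'I_n) : Nil2 n := proj _ (free_gen i).

Section Action.
Variable n : nat.
Implicit Types (i : 'I_n.-1) (a : aut (Nil2 n)).

Lemma succ_subproof i : i.+1 < n.
Proof. by case: n i => [[]|m i] //=; rewrite ltnS; apply: ltn_ord. Qed.

Definition ix i : 'I_n := widen_ord (leq_pred n) i.
Definition ixS i : 'I_n := Ordinal (succ_subproof i).

Definition sigma_action i a : Prop :=
  [/\ a (xgen (ix i)) = xgen (ix i) * xgen (ixS i) * (xgen (ix i))^-1,
      a (xgen (ixS i)) = xgen (ix i) &
      forall l : 'I_n, l != ix i -> l != ixS i -> a (xgen l) = xgen l].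

Definition rho_action i a : Prop :=
  [/\ a (xgen (ix i)) = xgen (ixS i),
      a (xgen (ixS i)) = xgen (ix i) &
      forall l : 'I_n, l != ix i -> l != ixS i -> a (xgen l) = xgen l].

Definition sends_generators (phi : UVB n -> aut (Nil2 n)) : Prop :=
  forall i, sigma_action i (phi (sigma i)) /\ rho_action i (phi (rho i)).

End Action.

(* Main.v *)
(** The automorphism group of [N_n] acts through the images of the generators,
    so each defining relation of [UVB_n] reduces to an identity between the
    images of the [x_l].  All of them except (F2) already hold in the free group;
    for (F2) the image of [x_i] is [x_i x_j x_k x_j^-1 x_i^-1] on one side
    and [x_j x_i x_k x_i^-1 x_j^-1] on the other, and these agree because
    [x_i x_j] and [x_j x_i] differ by a commutator, which is central in [N_n]. *)

Require Import Defs.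
From HB Require Import structures.
From mathcomp Require Import all_boot.
From mathcomp Require Import zify.
From mathcomp Require Import boolp classical_sets.

Set Implicit Arguments.
Unset Strict Implicit.
Unset Printing Implicit Defensive.

Local Open Scope group_scope.

(** [gmulf1] and [gmulfV] are stated for [UMagmaMorphism.type], which unification
    does not infer from [{multiplicative G -> H}]. *)
Section GroupMorphism.
Variables (G H : groupType) (f : {multiplicative G -> H}).

Lemma mulf1 : f 1 = 1.
Proof. by apply: (mulgI (f 1)); rewrite -gmulfM !mulg1. Qed.

Lemma mulfV : {morph f : x / x^-1}.
Proof. by move=> x; apply: (mulgI (f x)); rewrite -gmulfM !mulgV mulf1. Qed.

Lemma mulfJ : {morph f : x y / x ^ y}.
Proof. by move=> x y; rewrite !gmulfM mulfV. Qed.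

Lemma mulfR : {morph f : x y / [~ x, y]}.
Proof. by move=> x y; rewrite !gmulfM !mulfV. Qed.

Lemma kernel_normal : normal_subgroup [set x | f x = 1]%classic.
Proof.
split; first split=> /= [|x y fx fy|x fx]; first exact: mulf1.
- by rewrite gmulfM fx fy mulg1.
- by rewrite mulfV fx invg1.
by move=> x y /= fx; rewrite mulfJ fx conj1g.
Qed.

End GroupMorphism.

(** * Universal properties *)

Section FreeGroupLift.
Variables (X : choiceType) (G : groupType) (f : X -> G).

Definition letter_lift (a : letter X) : G := if a.2 then f a.1 else (f a.1)^-1.

Definition word_lift (s : seq (letter X)) : G :=
  foldr (fun a g => letter_lift a * g) 1 s.

Lemma letter_lift_invl a : letter_lift (invl a) = (letter_lift a)^-1.
Proof. by case: a => x [] //=; rewrite /letter_lift /= invgK. Qed.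

(** When [push] cancels, [a] and the head of [s] are inverse letters, so their images cancel too;
    hence evaluation respects free reduction. *)
Lemma word_lift_push a s : word_lift (push a s) = letter_lift a * word_lift s.
Proof.
case: s => [|b s] //=; case: eqVneq => [->|//].
by rewrite letter_lift_invl mulVKg.
Qed.

Definition free_lift (u : free_group X) : G := word_lift (word u).

Lemma free_liftM : {morph free_lift : u v / u * v}.
Proof.
move=> u v; rewrite /free_lift /=; elim: (word u) => [|a s IHs] /=.
  by rewrite mul1g.
by rewrite word_lift_push IHs mulgA.
Qed.

HB.instance Definition _ :=
  isMultiplicative.Build (free_group X) G free_lift free_liftM.

Lemma free_lift_gen x : free_lift (free_gen x) = f x.
Proof. exact: mulg1. Qed.

End FreeGroupLift.

Lemma free_group_ext (X : choiceType) (G : groupType)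
    (f g : {multiplicative free_group X -> G}) :
  (forall x, f (free_gen x) = g (free_gen x)) -> f =1 g.
Proof.
move=> fg [s rs]; elim: s rs => [|[x b] s IHs] rs.
  have -> : FreeGroup rs = 1 by apply: val_inj.
  by rewrite !mulf1.
have rs' : reduced s by apply: path_sorted rs.
pose a : free_group X := if b then free_gen x else (free_gen x)^-1.
have fga : f a = g a by rewrite /a; case: b {rs a}; rewrite ?mulfV fg.
suff -> : FreeGroup rs = a * FreeGroup rs' by rewrite !gmulfM fga IHs.
have wa : word a = [:: (x, b)] by rewrite /a; case: b {rs a fga}.
apply: val_inj; rewrite /= wa.
(* The word is reduced, so pushing its head back onto its tail cancels nothing. *)
by have /= := foldr_push0 rs; rewrite foldr_push0 // => ->.
Qed.

Lemma quotient_lift (G H : groupType) (N : normalSubgroup G)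
    (f : {multiplicative G -> H}) : (forall x, N x -> f x = 1) ->
  exists g : {multiplicative quotient_group N -> H}, forall x, g (proj N x) = f x.
Proof.
(* The choice of representative is harmless: two elements of a coset differ by a factor in [N],
   which [f] kills. *)
move=> fN; pose g (u : quotient_group N) : H := f (repr u).
have gE x : g (proj N x) = f x.
  have /asboolP/fN := repr_proj N x; rewrite gmulfM mulfV => e.
  by rewrite -[RHS](mulVKg (f (repr (proj N x)))) e mulg1.
have gM : {morph g : u v / u * v}.
  move=> u v; rewrite -[u]proj_repr -[v]proj_repr -projM !gE.
  exact: gmulfM.
pose gm := isMultiplicative.Build (quotient_group N) H g gM.
by exists (HB.pack_for {multiplicative quotient_group N -> H} g gm).
Qed.

Lemma presented_group_lift (X : choiceType)
    (rel : free_group X -> free_group X -> Prop) (G : groupType) (f : X -> G) :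
    (forall u v, rel u v -> free_lift f u = free_lift f v) ->
  exists g : {multiplicative presented_group rel -> G},
    forall x, g (proj _ (free_gen x)) = f x.
Proof.
move=> frel.
have [|g gE] := @quotient_lift _ _
    (normal_closure [set w | exists u v, rel u v /\ w = u * v^-1]%classic)
    (free_lift f); last by exists g => x; rewrite gE; apply: free_lift_gen.
(* The normal closure lies in every normal subgroup containing the relators, in particular in the
   kernel of the lift. *)
move=> w /(_ [set u | free_lift f u = 1]%classic); apply.
split; first exact: kernel_normal.
by move=> _ [u [v [ruv ->]]] /=; rewrite gmulfM mulfV /= (frel u v ruv) mulgV.
Qed.

Lemma quotient_free_ext (X : choiceType) (G : groupType)
    (N : normalSubgroup (free_group X))
    (f g : {multiplicative quotient_group N -> G}) :
  (forall x, f (proj N (free_gen x)) = g (proj N (free_gen x))) -> f =1 g.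
Proof.
move=> fg u; rewrite -[u]proj_repr.
by apply: (@free_group_ext _ _ (f \o proj N) (g \o proj N)) => x; apply: fg.
Qed.

(** * Endomorphisms of the free 2-step nilpotent group *)

Definition nilpotent2 (G : groupType) : Prop :=
  forall x y z : G, commute [~ x, y] z.

(** The elements that [f] sends to the centre form a subgroup containing all commutators, hence the
    derived subgroup; a commutator with such an element is sent to 1. *)
Lemma gamma3_triv (G H : groupType) (f : {multiplicative G -> H}) :
  nilpotent2 H -> forall x, gamma3 G x -> f x = 1.
Proof.
move=> Hnil.
have fZ x : commutator_subgroup [set: G]%classic [set: G]%classic x ->
    forall z, commute (f x) z.
  move/(_ [set x | forall z, commute (f x) z]%classic); apply.
  split; last by move=> _ [a _ [b _ <-]] z; rewrite mulfR; apply: Hnil.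
  split=> /= [z|a b Ha Hb z|a Ha z].
  - by rewrite mulf1; apply/commute_sym/commute1.
  - by rewrite gmulfM; apply/commute_sym/commuteM; apply/commute_sym.
  - by rewrite mulfV; apply/commute_sym/commuteV/commute_sym.
move=> x /(_ [set x | f x = 1]%classic); apply.
split; first by have [] := kernel_normal f.
move=> _ [a _ [b Hb <-]] /=; rewrite mulfR.
exact/eqP/commgP/commute_sym/fZ.
Qed.

(** Both sides are conjugates of [z], by [x * y] and by [y * x]; these differ by the factor
    [[~ x, y]], which commutes with [z]. *)
Lemma nilpotent2_conjC (G : groupType) : nilpotent2 G ->
  forall x y z : G, x * y * z * y^-1 * x^-1 = y * x * z * x^-1 * y^-1.
Proof.
move=> Gnil x y z; transitivity (x * y * z * (x * y)^-1).
  by rewrite invgM !mulgA.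
rewrite (commgC x y); move: [~ x, y] (Gnil x y z) => c cz.
by rewrite -(mulgA (y * x)) cz !invgM !mulgA mulgK.
Qed.

Lemma Nil2_nilpotent2 n : nilpotent2 (Nil2 n).
Proof.
move=> x y z; rewrite -[x]proj_repr -[y]proj_repr -[z]proj_repr.
(* The two sides are swapped because [gamma3] has the inner commutator in second place. *)
rewrite -mulfR; apply/commute_sym/commgP/eqP; rewrite -mulfR -(mulf1 (proj _)).
apply/esym/projP/asboolP; rewrite invg1 mul1g.
move=> H [_]; apply; exists (repr z) => //; exists [~ repr x, repr y] => //.
by move=> K [_]; apply; exists (repr x) => //; exists (repr y).
Qed.

Lemma Nil2_lift n (f : 'I_n -> Nil2 n) :
  exists g : {multiplicative Nil2 n -> Nil2 n}, forall i, g (xgen i) = f i.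
Proof.
have [|g gE] := @quotient_lift _ _ (gamma3 (free_group 'I_n)) (free_lift f).
  exact/gamma3_triv/Nil2_nilpotent2.
by exists g => i; rewrite gE; apply: free_lift_gen.
Qed.

HB.instance Definition _ (G : groupType) (a : aut G) :=
  isMultiplicative.Build G G (aut_fun a) (autM a).

Lemma aut_Nil2_ext n (a b : aut (Nil2 n)) :
  (forall i, a (xgen i) = b (xgen i)) -> a = b.
Proof. by move=> ab; apply/aut_eq/quotient_free_ext. Qed.

Lemma Nil2_aut n (f g : {multiplicative Nil2 n -> Nil2 n}) :
    (forall i, g (f (xgen i)) = xgen i) -> (forall i, f (g (xgen i)) = xgen i) ->
  exists a : aut (Nil2 n), forall i, a (xgen i) = f (xgen i).
Proof.
move=> gf fg.
have fK : cancel f g by apply: (@quotient_free_ext _ _ _ (g \o f) idfun).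
have gK : cancel g f by apply: (@quotient_free_ext _ _ _ (f \o g) idfun).
by exists (@Aut _ f (@gmulfM _ _ f) (Bijective fK gK)).
Qed.

(** * The automorphisms attached to the generators *)

Section GeneratorActions.
Variables (n : nat) (i : 'I_n.-1).

Lemma ix_neq : ((ixS i == ix i) = false) * ((ix i == ixS i) = false).
Proof. by rewrite -!val_eqE /=; split; lia. Qed.

Lemma sigma_action_exists : exists a : aut (Nil2 n), sigma_action i a.
Proof.
have [f fE] := Nil2_lift (fun l : 'I_n =>
  if l == ix i then xgen (ix i) * xgen (ixS i) * (xgen (ix i))^-1
  else if l == ixS i then xgen (ix i) else xgen l).
(* The inverse is read off from [f]: the image of [ixS i] is the generator at [ix i], and
   conjugating the image of [ix i] by it recovers the generator at [ixS i]. *)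
have [g gE] := Nil2_lift (fun l : 'I_n =>
  if l == ix i then xgen (ixS i)
  else if l == ixS i then (xgen (ixS i))^-1 * xgen (ix i) * xgen (ixS i)
  else xgen l).
have [l|l|a aE] := @Nil2_aut _ f g.
- rewrite fE; case: ifP => [/eqP ->|li].
    by rewrite !gmulfM mulfV !gE !eqxx ix_neq -!mulgA mulgV mulg1 mulVKg.
  case: ifP => [/eqP ->|lS]; first by rewrite gE eqxx.
  by rewrite gE li lS.
- rewrite gE; case: ifP => [/eqP ->|li]; first by rewrite fE ix_neq eqxx.
  case: ifP => [/eqP ->|lS]; last by rewrite fE li lS.
  by rewrite !gmulfM mulfV !fE !eqxx ix_neq -!mulgA mulVg mulg1 mulKg.
exists a; split; rewrite ?aE ?fE ?ix_neq ?eqxx // => l /negbTE li /negbTE lS.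
by rewrite aE fE li lS.
Qed.

Lemma rho_action_exists : exists a : aut (Nil2 n), rho_action i a.
Proof.
have [f fE] := Nil2_lift (fun l : 'I_n =>
  if l == ix i then xgen (ixS i) else if l == ixS i then xgen (ix i) else xgen l).
have ffE l : f (f (xgen l)) = xgen l.
  rewrite fE; case: ifP => [/eqP ->|li]; first by rewrite fE ix_neq eqxx.
  case: ifP => [/eqP ->|lS]; first by rewrite fE eqxx.
  by rewrite fE li lS.
have [a aE] := Nil2_aut ffE ffE.
exists a; split; rewrite ?aE ?fE ?ix_neq ?eqxx // => l /negbTE li /negbTE lS.
by rewrite aE fE li lS.
Qed.

Lemma sigma_action_unique (a b : aut (Nil2 n)) :
  sigma_action i a -> sigma_action i b -> a = b.
Proof.
move=> [a1 a2 a3] [b1 b2 b3]; apply: aut_Nil2_ext => l.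
have [->|li] := eqVneq l (ix i); first by rewrite a1 b1.
by have [->|lS] := eqVneq l (ixS i); [rewrite a2 b2|rewrite a3 ?b3].
Qed.

Lemma rho_action_unique (a b : aut (Nil2 n)) :
  rho_action i a -> rho_action i b -> a = b.
Proof.
move=> [a1 a2 a3] [b1 b2 b3]; apply: aut_Nil2_ext => l.
have [->|li] := eqVneq l (ix i); first by rewrite a1 b1.
by have [->|lS] := eqVneq l (ixS i); [rewrite a2 b2|rewrite a3 ?b3].
Qed.

End GeneratorActions.

(** * Verification of the defining relations *)

Section Relations.
Variables (n : nat) (s r : 'I_n.-1 -> aut (Nil2 n)).
Hypothesis sP : forall i, sigma_action i (s i).
Hypothesis rP : forall i, rho_action i (r i).

(** One conditional formula replaces the three clauses, so that rewriting can evaluate at an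
    arbitrary generator. *)
Let actE :
  (forall i l, s i (xgen l) =
    if l == ix i then xgen (ix i) * xgen (ixS i) * (xgen (ix i))^-1
    else if l == ixS i then xgen (ix i) else xgen l) *
  (forall i l, r i (xgen l) =
    if l == ix i then xgen (ixS i)
    else if l == ixS i then xgen (ix i) else xgen l).
Proof.
split=> i l; [have [E1 E2 E3] := sP i|have [E1 E2 E3] := rP i];
by case: ifPn => [/eqP-> //|li]; case: ifPn => [/eqP-> //|lS]; apply: E3.
Qed.

Let eval_mul (a b : aut (Nil2 n)) x : (a * b) x = b (a x).
Proof. by []. Qed.

(** Adjacent indices involve three generators. Once the shared one is written [ixS i], these rules
    and [ix_neq] decide every comparison among them. *)
Let ix_next (i j : 'I_n.-1) : j = i.+1 :> nat ->
  (ix j = ixS i) *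
  ((ixS j == ix i) = false) * ((ixS j == ixS i) = false) *
  ((ix i == ixS j) = false) * ((ixS i == ixS j) = false).
Proof. by move=> ji; do !split; try apply: val_inj; rewrite -?val_eqE /=; lia. Qed.

Let ix_far (i j : 'I_n.-1) : far i j ->
  ((ix i == ix j) = false) * ((ix i == ixS j) = false) *
  ((ixS i == ix j) = false) * ((ixS i == ixS j) = false) *
  ((ix j == ix i) = false) * ((ixS j == ix i) = false) *
  ((ix j == ixS i) = false) * ((ixS j == ixS i) = false).
Proof. by rewrite /far => ij; do !split; rewrite -val_eqE /=; lia. Qed.

(** Compares two automorphisms at an arbitrary generator: the action rules evaluate products, [E]
    settles comparisons of indices, an undecided test on the generator causes a case split, and the
    resulting group words are simplified. *)
Ltac on_generators E :=
  apply: aut_Nil2_ext => ?; rewrite ?eval_mul;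
  repeat first
    [ progress rewrite ?(gmulfM, mulfV, actE, ix_neq, eqxx, E) /=
    | match goal with
      | ne : (?l == ?x) = false |- context [?l == ?x] => rewrite ne
      | |- context [?l == ?x] =>
        is_var l; case: (eqVneq l x) => [?|/negbTE ?]; [subst l|]
      end ];
  rewrite ?invgM ?invgK ?mulgA ?(mulgK, mulgVK) //.

Lemma uvb_rel_action u v : uvb_rel u v ->
  let f (l : uvb_letter n) := match l with inl i => s i | inr i => r i end in
  free_lift f u = free_lift f v.
Proof.
move=> uv f.
have liftE : (forall i, free_lift f (free_sigma i) = s i) *
             (forall i, free_lift f (free_rho i) = r i).
  by split=> i; apply: free_lift_gen.
case: uv => [i j /ix_next E|i j /ix_far E|i j /ix_next E|i j /ix_far E|i
            |i j /ix_far E|i j /ix_next E|i j /ix_next E|i j /ix_next E];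
  rewrite ?expg2 !free_liftM ?liftE.
(* This is [R5]: it has a single index, so [ix_neq] supplies the comparisons, and its right side is
   the lift of 1. *)
5: by rewrite (mulf1 (free_lift f)); on_generators (ix_neq i).
all: on_generators E.
(* What remains is [RF2] at [xgen (ix i)]. *)
exact/nilpotent2_conjC/Nil2_nilpotent2.
Qed.

End Relations.

(** * Existence and uniqueness of the representation *)

Theorem proposition4p5 (n : nat) (n_gt0 : (0 < n)%N) :
  exists phi : {multiplicative UVB n -> aut (Nil2 n)},
    sends_generators phi /\
    (forall psi : {multiplicative UVB n -> aut (Nil2 n)},
       sends_generators psi -> psi =1 phi).
Proof.
have /choice[s sP] := @sigma_action_exists n.
have /choice[r rP] := @rho_action_exists n.
have [phi phiE] := presented_group_lift (uvb_rel_action sP rP).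
have phi_sigma i : phi (sigma i) = s i := phiE (inl i).
have phi_rho i : phi (rho i) = r i := phiE (inr i).
exists phi; split=> [i|psi psiP]; first by rewrite phi_sigma phi_rho.
(* For uniqueness it suffices to compare on the letters, where the prescribed action determines the
   automorphism. *)
apply: quotient_free_ext => -[i|i]; have [psi_sigma psi_rho] := psiP i.
- apply: sigma_action_unique psi_sigma _.
  by rewrite -[proj _ _]/(sigma i) phi_sigma.
- apply: rho_action_unique psi_rho _.
  by rewrite -[proj _ _]/(rho i) phi_rho.
Qed.
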